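(* Let $a>0$, $\varepsilon>0$, $K_0>0$, and let $q_1,q_2$ be potentials on $(0,b_1),(0,b_2)$ with $b_j>a$, each (with a boundary condition at $b_j$ where applicable) as in one of the Cases 1–4 of the context, with $m$-functions $m_j(z)$ and $m_j(z,x)$. Suppose $q_1=q_2$ on $[0,a]$, and suppose $C>0$ is a constant such that for $j=1,2$ $$|m_j(-\kappa^2,x)+\kappa|\le C$$ for all $x\in[0,a]$ and all $\kappa$ in the region $\arg(\kappa)\in(-\frac{\pi}{2}+\varepsilon,-\varepsilon)$, $|\kappa|\ge K_0$. Then for all $\kappa$ in the same region, $$|m_1(-\kappa^2)-m_2(-\kappa^2)|\le 2C\exp\left(-2a[\operatorname{Re}(\kappa)-C]\right).$$
   Context: Setting. $q$ is a real-valued function on $(0,b)$ and one of the following holds. Case 1: $b<\infty$, $q\in L^1((0,b))$, and a parameter $h\in\mathbb R\cup\{\infty\}$ is fixed, giving the boundary condition $u'(b_-)+hu(b_-)=0$ (with $h=\infty$ meaning $u(b_-)=0$). In Cases 2–4, $b=\infty$ and $\int_0^a|q(x)|\,dx<\infty$ for all $a<\infty$. Case 2: $\sup_{a>0}\int_a^{a+1}\max(-q(x),0)\,dx<\infty$. Case 3: the condition of Case 2 fails, but $-\frac{d^2}{dx^2}+q$ is limit point at $\infty$, i.e. for each $z$ with $\operatorname{Im}z>0$ the equation $-u''+qu=zu$ has, up to constant multiples, a unique solution that is $L^2$ at $\infty$. Case 4: $-\frac{d^2}{dx^2}+q$ is limit circle at $\infty$ (all solutions of $-u''+qu=zu$ are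 $L^2$ at $\infty$ for $\operatorname{Im} z>0$); a self-adjoint boundary condition at infinity is fixed by a nonzero solution $u_0$ of $-u''+qu=iu$ with $\lim_{x\to\infty}[u_0\overline{u_0'}-u_0'\overline{u_0}](x)=0$, and $u$ satisfies the boundary condition if $\lim_{x\to\infty}[u_0(x)u'(x)-u_0'(x)u(x)]=0$. For $\operatorname{Im}z>0$ let $u(x,z)$ be a nonzero solution of $-u''+qu=zu$ satisfying the boundary condition at $b$ (in Cases 2, 3: square integrable near $\infty$), and define $m(z,x)=u'(x,z)/u(x,z)$ and $m(z)=m(z,0_+)$ (at $x=0$ the value of $m(z,x)$ is the limit $x\downarrow 0$). *)

(* Defs.v *)
(* R[i] carries no R-normed structure here, so limits and derivatives of functions
   R -> R[i] are taken on real and imaginary parts separately. *)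
From HB Require Import structures.
From mathcomp Require Import all_boot all_order all_algebra.
From mathcomp Require Import all_classical all_reals all_analysis.
From mathcomp Require Export complex.

Set Implicit Arguments.
Unset Strict Implicit.
Unset Printing Implicit Defensive.

Import Order.TTheory GRing.Theory Num.Theory.
Import numFieldNormedType.Exports.
Import Normc.

Local Open Scope classical_set_scope.
Local Open Scope ring_scope.
Local Open Scope complex_scope.

Section ComplexValued.
Variable R : realType.
Implicit Types (f : R -> R[i]) (x y c d : R).

Definition re f : R -> R := fun x => complex.Re (f x).
Definition im f : R -> R := fun x => complex.Im (f x).

Definition cvgC (F : set_system R) f (l : R[i]) : Prop :=
  re f x @[x --> F] --> complex.Re l /\ im f x @[x --> F] --> complex.Im l.

Definition limC (F : set_system R) f : R[i] :=
  lim (re f x @[x --> F]) +i* lim (im f x @[x --> F]).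

Definition derivableC f x : Prop :=
  derivable (re f) x 1 /\ derivable (im f) x 1.

Definition derivC f : R -> R[i] :=
  fun x => derive1 (re f) x +i* derive1 (im f) x.

Definition abs_cont f c d : Prop :=
  forall eps : R, 0 < eps -> exists2 delta : R, 0 < delta &
    forall (n : nat) (l r : 'I_n -> R),
      (forall i, c <= l i /\ l i <= r i /\ r i <= d) ->
      trivIset [set: 'I_n] (fun i => [set` `]l i, r i[]) ->
      \sum_(i < n) (r i - l i) < delta ->
      \sum_(i < n) normc (f (r i) - f (l i)) < eps.

Definition L2_at_infty f : Prop :=
  exists2 a : R, 0 < a &
    (@lebesgue_measure R).-integrable `[a, +oo[
      (fun x => (normc (f x) ^+ 2)%:E).

(* Principal argument, in ]-pi, pi] for z != 0 (the value at 0 is junk). *)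
Definition Arg (z : R[i]) : R :=
  let t := acos (complex.Re z / normc z) in
  if 0 <= complex.Im z then t else - t.

End ComplexValued.

Section Schrodinger.
Variable R : realType.
Implicit Types (q : R -> R) (b : \bar R) (u v : R -> R[i]) (z : R[i]).

(* The condition that u is locally absolutely continuous is subsumed by that on
   u', which makes u continuously differentiable. *)
Definition solution q b z u : Prop :=
  [/\ forall x : R, 0 < x -> (x%:E < b)%E -> derivableC u x,
      forall c d : R, 0 < c -> c <= d -> (d%:E < b)%E -> abs_cont (derivC u) c d
    & {ae @lebesgue_measure R, forall x : R, 0 < x -> (x%:E < b)%E ->
        derivableC (derivC u) x /\
        - derivC (derivC u) x + (q x)%:C * u x = z * u x}].

Definition nonzero_on b u : Prop :=
  exists x : R, [/\ 0 < x, (x%:E < b)%E & u x != 0].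

Definition wronskian u v : R -> R[i] :=
  fun x => u x * derivC v x - derivC u x * v x.

Definition neg_part_bounded q : Prop :=
  (ereal_sup [set (\int[@lebesgue_measure R]_(x in `[a, (a + 1)%R])
                     (Num.max (- q x) 0)%:E)%E | a in [set a : R | (0 < a)%R]]
   < +oo)%E.

Definition limit_point q : Prop :=
  forall z, 0 < complex.Im z ->
    exists u, [/\ solution q +oo z u, nonzero_on +oo u, L2_at_infty u
      & forall v, solution q +oo z v -> L2_at_infty v ->
          exists c : R[i], forall x : R, 0 < x -> v x = c * u x].

Definition limit_circle q : Prop :=
  forall z, 0 < complex.Im z ->
    forall u, solution q +oo z u -> L2_at_infty u.

(* The four cases, each with the data of its boundary condition at b.  In Case1,
   h = None stands for h = oo, the Dirichlet condition u(b-) = 0. *)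
Inductive endpoint : Type :=
  | Case1 (b : R) (h : option R)
  | Case2
  | Case3
  | Case4 (u0 : R -> R[i]).

Definition right_end (e : endpoint) : \bar R :=
  if e is Case1 b _ then b%:E else +oo%E.

Definition locally_integrable_from_0 q : Prop :=
  forall a : R, 0 < a ->
    (@lebesgue_measure R).-integrable `]0, a[ (EFin \o q).

Definition admissible (e : endpoint) q : Prop :=
  match e with
  | Case1 b _ =>
      0 < b /\ (@lebesgue_measure R).-integrable `]0, b[ (EFin \o q)
  | Case2 => locally_integrable_from_0 q /\ neg_part_bounded q
  | Case3 => [/\ locally_integrable_from_0 q, ~ neg_part_bounded q & limit_point q]
  | Case4 u0 =>
      [/\ locally_integrable_from_0 q, limit_circle q, solution q +oo 'i u0,
          nonzero_on +oo u0
        & cvgC +oo%R (wronskian u0 (fun x => (u0 x)^*)) 0]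
  end.

Definition boundary_condition (e : endpoint) u : Prop :=
  match e with
  | Case1 b h => exists l l' : R[i],
      [/\ cvgC b^'- u l, cvgC b^'- (derivC u) l'
        & if h is Some r then l' + r%:C * l = 0 else l = 0]
  | Case2 | Case3 => L2_at_infty u
  | Case4 u0 => cvgC +oo%R (wronskian u0 u) 0
  end.

Definition weyl_solution (e : endpoint) q z u : Prop :=
  [/\ solution q (right_end e) z u, nonzero_on (right_end e) u
    & boundary_condition e u].

(* For u = u(., z) a Weyl solution, m_fun u x is m(z, x) and m_fun u 0 is m(z). *)
Definition m_fun u (x : R) : R[i] :=
  if x == 0 then limC 0^'+ (fun t => derivC u t / u t)
  else derivC u x / u x.

End Schrodinger.

(* Main.v *)
(** Put d = m1 - m2.  If Re k <= C the bound is the triangle inequality, so let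
    Re k > C.  On (0, a] the Wronskian W = u1 u2' - u1' u2 is absolutely
    continuous with W' = 0 almost everywhere, because q1 = q2 there; hence W is
    constant and d = - W / (u1 u2).  From Re (u_j' / u_j) <= C - Re k one gets
    |u_j(a)| <= |u_j(x)| exp ((C - Re k) (a - x)), so that
    |d(x)| <= |d(a)| exp (2 (C - Re k) (a - x)), where |d(a)| <= 2 C; let x -> 0.
    The existence of m1(0+) and m2(0+) separately is not needed: d is Lipschitz
    on (0, a], so the real parts of m1 and m2 both converge at 0+ or both diverge,
    and likewise for the imaginary parts; divergent limits have the same junk
    value. *)
Require Import Defs.
From HB Require Import structures.
From mathcomp Require Import all_boot all_order all_algebra.
From mathcomp Require Import all_classical all_reals all_analysis.
From mathcomp Require Import measurable_realfun lra ring complex.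

Set Implicit Arguments.
Unset Strict Implicit.
Unset Printing Implicit Defensive.

Import Order.TTheory GRing.Theory Num.Theory.
Import numFieldNormedType.Exports.
Import Normc.
(* Re-imported because all_algebra shadows derivC. *)
Import Defs.

Local Open Scope classical_set_scope.
Local Open Scope ring_scope.
Local Open Scope complex_scope.

(** * Absolutely continuous functions with zero derivative almost everywhere *)

Section AbsCont.
Variable R : realType.
Implicit Types (f g : R -> R[i]) (c d : R).

(** Compactness of [c, d] in the form of Cousin's lemma: a transitive interval property that holds
    locally around each point spreads to the whole interval. The proof looks at the supremum of the
    points reachable from c. *)
Lemma cousin (Q : R -> R -> Prop) (c d : R) : c <= d ->
  (forall x y z, x <= y -> y <= z -> Q x y -> Q y z -> Q x z) ->
  (forall x, c <= x <= d -> exists2 e, 0 < e &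
     forall y z, y <= x <= z -> x - e < y -> z < x + e -> Q y z) ->
  Q c d.
Proof.
move=> cd Qtrans Qloc.
pose S := [set x | c <= x <= d /\ Q c x].
have Sc : S c.
  split; first by rewrite lexx.
  have [|e e0 He] := Qloc c; first by rewrite lexx.
  by apply: He; rewrite ?lexx ?ltrBlDr ?ltrDl.
have Sub : ubound S d by move=> x [/andP[]].
have hS : has_sup S by split; [exists c | exists d].
have cs : c <= sup S by apply: ub_le_sup => //; exists d.
have sd : sup S <= d by apply: ge_sup => //; exists c.
have [|e e0 He] := Qloc (sup S); first by rewrite cs.
have [y [/andP[cy yd] Qcy] ye] := sup_adherent e0 hS.
have ys : y <= sup S by apply: ub_le_sup; [exists d | split => //; rewrite cy].
(* One local step around [sup S] joins y, just below it, to z. Hence z lies in S, so z <= [sup S],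
   and this rules out every value of the minimum except d. *)
pose z := Num.min d (sup S + e / 2).
have sz : sup S <= z by rewrite le_min sd lerDl divr_ge0// ltW.
have Qcz : Q c z.
  apply: (Qtrans _ y) => //; first exact: le_trans sz.
  apply: He => //; first by rewrite ys.
  by rewrite gt_min ltrD2l gtr_pMr// invf_lt1// ltr1n orbT.
have Sz : S z by split => //; rewrite (le_trans cs sz) ge_min lexx.
have zs : z <= sup S by apply: ub_le_sup => //; exists d.
suff <- : z = d by [].
apply/eqP; rewrite eq_le ge_min lexx/=.
by move: zs; rewrite ge_min gerDl [e / 2 <= 0]leNgt divr_gt0// orbF => /le_trans; apply.
Qed.

Lemma normc_ReIm_le (z : R[i]) : normc z <= `|complex.Re z| + `|complex.Im z|.
Proof.
case: z => x y /=.
rewrite -[leRHS]ger0_norm ?addr_ge0// -sqrtr_sqr ler_wsqrtr//.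
by rewrite sqrrD !real_normK ?num_real// lerD2r lerDl mulrn_wge0// mulr_ge0.
Qed.

Lemma derive0_near (h : R -> R) (x e : R) : 0 < e ->
  is_derive x 1 h 0 ->
  exists2 d, 0 < d & forall y, `|y - x| < d -> `|h y - h x| <= e * `|y - x|.
Proof.
move=> e0 [hd h0].
have : (fun t : R => t^-1 *: (h (t *: (1 : R) + x) - h x)) @ 0^' --> 'D_1 h x.
  exact: hd.
rewrite h0 =>  /cvgr0Pnorm_lt /(_ e e0).
rewrite /= near_withinE => -[d /= d0 H]; exists d => // y yd.
have [->|yx] := eqVneq y x; first by rewrite !subrr normr0 mulr0.
have /= := H (y - x); rewrite /ball_/= sub0r normrN yd subr_eq0 => /(_ isT yx).
rewrite [_ *: 1]mulr1 subrK normrZ normfV => /ltW.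
by rewrite mulrC ler_pdivrMr ?normr_gt0 ?subr_eq0.
Qed.

(** The estimates from x to z and from x to y add up, because y and z lie on opposite sides of x and
    so |z - x| + |y - x| = z - y. This straddling form is the local hypothesis of [cousin]. *)
Lemma derivC0_near f (x e : R) : 0 < e -> derivableC f x -> derivC f x = 0 ->
  exists2 d, 0 < d & forall y z, y <= x <= z -> x - d < y -> z < x + d ->
    normc (f z - f y) <= e * (z - y).
Proof.
move=> e0 [d1 d2] [r0 i0].
have e20 : 0 < e / 2 by rewrite divr_gt0.
have [|dr dr0 Hr] := @derive0_near (re f) x _ e20.
  by split => //; rewrite -derive1E.
have [|di di0 Hi] := @derive0_near (im f) x _ e20.
  by split => //; rewrite -derive1E.
exists (Num.min dr di); first by rewrite lt_min dr0.
move=> y z /andP[yx xz] dy dz.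
have [zr zi] : `|z - x| < dr /\ `|z - x| < di.
  by apply/andP; rewrite -lt_min ger0_norm ?subr_ge0// ltrBlDl.
have [yr yi] : `|y - x| < dr /\ `|y - x| < di.
  by apply/andP; rewrite -lt_min distrC ger0_norm ?subr_ge0// ltrBlDl -ltrBlDr.
have comp (h : R -> R) : `|h z - h x| <= e / 2 * `|z - x| ->
    `|h y - h x| <= e / 2 * `|y - x| -> `|h z - h y| <= e / 2 * (z - y).
  move=> h1 h2; rewrite -(subrK (h x) (h z)) -addrA.
  apply: (le_trans (ler_normD _ _)); rewrite [`|h x - h y|]distrC.
  apply: (le_trans (lerD h1 h2)); rewrite -mulrDr ler_pM2l//.
  by rewrite ger0_norm ?subr_ge0// distrC ger0_norm ?subr_ge0// addrA subrK.
apply: (le_trans (normc_ReIm_le _)).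
rewrite [e in leRHS](splitr e) mulrDl; apply: lerD.
  by rewrite raddfB/=; apply: (comp (re f)); [exact: Hr | exact: Hr].
by rewrite raddfB/=; apply: (comp (im f)); [exact: Hi | exact: Hi].
Qed.

(* [le_normcD] is about [Rcomplex R]. *)
Lemma normcD (x y : R[i]) : normc (x + y) <= normc x + normc y.
Proof. exact: le_normcD. Qed.

Lemma normc_distC (x y : R[i]) : normc (x - y) = normc (y - x).
Proof.
by case: x y => a b [c d] /=; rewrite -[a - c]opprB -[b - d]opprB !sqrrN.
Qed.

Lemma normc_ge0 (x : R[i]) : 0 <= normc x.
Proof. by case: x => x y; exact: sqrtr_ge0. Qed.

Local Notation mu := (@lebesgue_measure R).

(** Passes from ordered lists, which concatenate well, to the indexed families in the definition of
    [abs_cont]. *)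
Lemma pairwise_trivIset (s : seq (R * R)) :
  pairwise (fun p q : R * R => p.2 <= q.1) s ->
  trivIset [set: 'I_(size s)]
    (fun i => [set` `]((tnth (in_tuple s) i).1), ((tnth (in_tuple s) i).2)[]).
Proof.
move=> /(pairwiseP (0, 0)) Hs.
have H (i j : 'I_(size s)) x : (i < j)%N ->
    x \in `]((tnth (in_tuple s) i).1), ((tnth (in_tuple s) i).2)[ ->
    x \in `]((tnth (in_tuple s) j).1), ((tnth (in_tuple s) j).2)[ -> False.
  move=> ij; rewrite !in_itv/= => /andP[_ x1] /andP[x2 _].
  have := Hs i j (ltn_ord i) (ltn_ord j) ij.
  rewrite -!(tnth_nth _ (in_tuple s)) leNgt => /negP; apply.
  exact: lt_trans x2 x1.
move=> i j _ _ [x [/= xi xj]]; apply/val_inj/eqP => /=.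
by case: ltngtP => // ij; exfalso; [apply: (H i j x) | apply: (H j i x)].
Qed.

Lemma open_measureI_itv (U : set R) (y z : R) : open U -> y <= z ->
  `]y, z[ `<=` U -> mu (U `&` `]y, z[) = (z - y)%:E.
Proof.
move=> oU yz yzU; rewrite setIC setIidl//.
by rewrite lebesgue_measure_itv/= lte_fin; case: ltgtP yz => //= -> _; rewrite subrr.
Qed.

(** Superadditivity of the measure of U on adjacent intervals; it makes the length bound in the
    proof of [abs_cont_derivC0] survive concatenation. *)
Lemma open_measureI_cat (U : set R) (x y z : R) : open U -> x <= y -> y <= z ->
  (mu (U `&` `]x, y[) + mu (U `&` `]y, z[) <= mu (U `&` `]x, z[))%E.
Proof.
move=> oU xy yz.
have mU : measurable U by exact: open_measurable.
rewrite -measureU//; first last.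
- apply/seteqP; split => // t [[_ /=]]; rewrite in_itv/= => /andP[_ ty] [_ /=].
  by rewrite in_itv/= => /andP[/(lt_trans ty)]; rewrite ltxx.
- exact: measurableI.
- exact: measurableI.
apply: le_measure; rewrite ?inE.
- by apply: measurableU; exact: measurableI.
- exact: measurableI.
move=> t [[Ut /=]|[Ut /=]]; rewrite !in_itv/= => /andP[t1 t2]; split => //=.
  by rewrite t1 (lt_le_trans t2).
by rewrite t2 (le_lt_trans xy).
Qed.

(* Cover the exceptional null set by an open U of small measure.  By Cousin's
   lemma, [c, d] is cut into finitely many intervals, each either contained in U,
   where absolute continuity applies, or such that f changes by at most e1
   times the length. *)
Lemma abs_cont_derivC0 f c d : c <= d -> abs_cont f c d ->
  {ae mu, forall x, c <= x <= d -> derivableC f x /\ derivC f x = 0} ->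
  f d = f c.
Proof.
move=> cd ACf aef; apply/eqP; rewrite -subr_eq0; apply/eqP/eq0_normc.
apply/eqP; rewrite eq_le normc_ge0 andbT; apply/ler_addgt0Pl => e e0; rewrite addr0.
(* Chosen so that e1 (d - c) <= e / 2; the added 1 keeps the denominator positive when c = d. *)
pose e1 := e / 2 / (d - c + 1).
have dc0 : 0 < d - c + 1 by rewrite ltr_wpDl// subr_ge0.
have e10 : 0 < e1 by rewrite divr_gt0// divr_gt0.
have [del del0 Hdel] := ACf (e / 2) (divr_gt0 e0 (ltr0Sn _ 1)).
have [N [mN N0 subN]] := aef.
have [|U [oU NU muU]] := lebesgue_regularity_outer mN _ del0.
  by apply: (@le_lt_trans _ _ 0%E) (ltry _); rewrite le_eqVlt; apply/orP; left; exact/eqP.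
(* Outer regularity bounds the measure of U minus N; since N is null, the same bound holds for U. *)
have {}muU : (mu U < del%:E)%E.
  have mU := open_measurable oU.
  apply: le_lt_trans muU; rewrite -[in leLHS](setDUK NU).
  apply: (le_trans (measureU2 _ _ _)) => //; first exact: measurableD.
  rewrite -[leRHS]add0e; apply: leeD => //.
  by rewrite le_eqVlt; apply/orP; left; exact/eqP.
(* The list s collects the intervals left to absolute continuity. Their total length is charged to
   U, and the rest of the increment of f is paid for by the slope e1. *)
pose Q y z := exists s : seq (R * R),
  [/\ all (fun p => (y <= p.1) && (p.1 <= p.2) && (p.2 <= z)) s,
      pairwise (fun p q : R * R => p.2 <= q.1) s,
      ((\sum_(p <- s) (p.2 - p.1))%:E <= mu (U `&` `]y, z[))%E
    & normc (f z - f y) <= \sum_(p <- s) normc (f p.2 - f p.1) + e1 * (z - y)].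
have : Q c d.
  apply: cousin => //.
    move=> x y z xy yz [s1 [al1 pw1 m1 n1]] [s2 [al2 pw2 m2 n2]].
    exists (s1 ++ s2); split.
    - rewrite all_cat; apply/andP; split; [move: al1|move: al2]; apply: sub_all => p.
        by move=> /andP[-> /=] /le_trans; apply.
      by move=> /andP[/andP[/(le_trans xy) -> ->]].
    - rewrite pairwise_cat pw1 pw2 !andbT; apply/allrelP => p q ps qs.
      move/allP: al1 => /(_ _ ps) /andP[_ py]; move/allP: al2 => /(_ _ qs) /andP[/andP[yq _] _].
      exact: le_trans py yq.
    - rewrite big_cat/= EFinD; apply: (le_trans (leeD m1 m2)).
      exact: open_measureI_cat.
    - rewrite -(subrK (f y) (f z)) -addrA; apply: (le_trans (normcD _ _)).
      apply: (le_trans (lerD n2 n1)); rewrite big_cat/= addrACA [in leRHS]addrC -mulrDr.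
      by rewrite addrA subrK addrC [X in _ + X]addrC.
  move=> x cxd.
  (* Around an exceptional point the list is the single interval (y, z), which lies in U; around any
     other point it is empty. *)
  have [Nx|Nx] := pselect (N x).
    have /= : nbhs x U by apply: open_nbhs_nbhs; split => //; exact: NU.
    move=> /nbhs_ballP[r /= r0 rU]; exists r => // y z /andP[yx xz] ry rz.
    exists [:: (y, z)]; split => /=.
    - by rewrite !lexx (le_trans yx).
    - by [].
    - rewrite big_seq1 open_measureI_itv//; first exact: le_trans xz.
      move=> t /=; rewrite in_itv/= => /andP[yt tz]; apply: rU; rewrite /ball/=.
      rewrite ltr_distlC (lt_trans ry)//= (lt_trans tz)//.
    - by rewrite big_seq1 lerDl; apply: mulr_ge0; [exact: ltW | rewrite subr_ge0; exact: le_trans yx xz].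
  have [Dx Dx0] : derivableC f x /\ derivC f x = 0.
    by apply: contrapT => H; apply: Nx; apply: subN => /= /(_ cxd).
  have [r r0 Hr] := derivC0_near e10 Dx Dx0.
  exists r => // y z yxz ry rz; exists [::]; split => //=.
  - by rewrite big_nil measure_ge0.
  - by rewrite big_nil add0r; exact: Hr.
move=> [s [al pw ms ns]].
apply: (le_trans ns); rewrite [e in leRHS](splitr e); apply: lerD.
  rewrite big_tnth; apply/ltW/(Hdel _ (fun i => (tnth (in_tuple s) i).1)
    (fun i => (tnth (in_tuple s) i).2)).
  - by move=> i; have /andP[/andP[-> ->] ->] := allP al _ (mem_tnth i (in_tuple s)).
  - exact: pairwise_trivIset.
  - rewrite -lte_fin; apply: le_lt_trans muU.
    rewrite -(big_tnth _ _ s xpredT (fun p : R * R => p.2 - p.1)); apply: (le_trans ms).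
    by apply: le_measure; rewrite ?inE; [apply: measurableI => //|..]; try exact: open_measurable.
by rewrite /e1 mulrAC ler_pdivrMr// ler_pM2l ?divr_gt0// lerDl.
Qed.

End AbsCont.

(** * Calculus for complex-valued functions of a real variable, and limits at 0+ *)

Section Deriv.
Variable R : realType.
Implicit Types (f g u v : R -> R[i]) (x y : R).

(** Keeps derivability and value together, so that the product and difference rules deliver both at
    once. *)
Definition is_derivC f x (l : R[i]) :=
  is_derive x 1 (re f) (complex.Re l) /\ is_derive x 1 (im f) (complex.Im l).

Lemma derivableC_is_derivC f x : derivableC f x -> is_derivC f x (derivC f x).
Proof. by move=> [fr fi]; split; apply: DeriveDef => //=; rewrite derive1E. Qed.

Lemma is_derivC_val f x l : is_derivC f x l -> derivableC f x /\ derivC f x = l.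
Proof.
move=> [[fr er] [fi ei]]; split; first by [].
by rewrite /derivC !derive1E er ei; case: l {er ei}.
Qed.

Lemma is_derivCM f g x l m : is_derivC f x l -> is_derivC g x m ->
  is_derivC (fun t => f t * g t) x (l * g x + f x * m).
Proof.
move=> [fr fi] [gr gi]; split.
- rewrite (_ : re _ = re f * re g - im f * im g); last first.
    by apply/funext => t; rewrite /re /im !fctE; case: (f t) (g t) => ? ? [].
  apply: is_derive_eq.
  by rewrite /re /im /GRing.scale/=; case: (f x) (g x) l m {fr fi gr gi} => ? ? [? ?] [? ?] [? ?] /=; ring.
- rewrite (_ : im _ = re f * im g + im f * re g); last first.
    by apply/funext => t; rewrite /re /im !fctE; case: (f t) (g t) => ? ? [].
  apply: is_derive_eq.
  by rewrite /re /im /GRing.scale/=; case: (f x) (g x) l m {fr fi gr gi} => ? ? [? ?] [? ?] [? ?] /=; ring.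
Qed.

Lemma is_derivCB f g x l m : is_derivC f x l -> is_derivC g x m ->
  is_derivC (fun t => f t - g t) x (l - m).
Proof.
move=> [fr fi] [gr gi]; split.
- rewrite (_ : re _ = re f - re g); last first.
    by apply/funext => t; rewrite /re !fctE; case: (f t) (g t) => ? ? [].
  by rewrite raddfB/=; exact: is_deriveB.
- rewrite (_ : im _ = im f - im g); last first.
    by apply/funext => t; rewrite /im !fctE; case: (f t) (g t) => ? ? [].
  by rewrite raddfB/=; exact: is_deriveB.
Qed.

(** The function g(t) exp(- lam t) has nonpositive derivative, hence is nonincreasing. *)
Lemma gronwall (g dg : R -> R) (lam x y : R) : x <= y ->
  (forall t, x <= t <= y -> is_derive t 1 g (dg t)) ->
  (forall t, x <= t <= y -> dg t <= lam * g t) ->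
  g y <= g x * expR (lam * (y - x)).
Proof.
move=> xy Dg le.
pose F t := g t * expR (- lam * t).
have DF t : x <= t <= y -> is_derive t 1 F ((dg t - lam * g t) * expR (- lam * t)).
  move=> txy; have Dgt := Dg t txy.
  have De : is_derive t 1 (fun s => expR (- lam * s)) (expR (- lam * t) * (- lam)).
    apply: (@is_derive1_comp _ expR (fun s => - lam * s)).
    rewrite (_ : (fun s => _) = (- lam) \*: (id : R -> R)); last by apply/funext.
    by apply: is_derive_eq; rewrite /GRing.scale/= mulr1.
  have [dF dFE] := is_deriveM Dgt De.
  apply: DeriveDef; first exact: dF.
  by apply: (etrans dFE); rewrite /GRing.scale/=; ring.
have H : F y <= F x.
  apply: (@ler0_derive1_nincr _ F x y) => //.
  - move=> t; rewrite in_itv/= => /andP[/ltW xt /ltW ty].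
    by have [] := DF t; rewrite ?xt.
  - move=> t; rewrite in_itv/= => /andP[/ltW xt /ltW ty].
    have txy : x <= t <= y by rewrite xt.
    have [_] := DF t txy; rewrite derive1E => ->.
    by rewrite mulr_le0_ge0 ?expR_ge0// subr_le0 le.
  - apply: derivable_within_continuous => t; rewrite in_itv/= => txy.
    by have [] := DF t txy.
rewrite -(@ler_pM2r _ (expR (- lam * y))) ?expR_gt0//.
by rewrite -mulrA -expRD; move: H; rewrite /F; congr (_ <= _ * expR _); ring.
Qed.

Lemma normc_Re (z : R[i]) : `|complex.Re z| <= normc z.
Proof.
by case: z => a b /=; rewrite -sqrtr_sqr ler_wsqrtr// lerDl sqr_ge0.
Qed.

Lemma normc_Im (z : R[i]) : `|complex.Im z| <= normc z.
Proof.
by case: z => a b /=; rewrite -sqrtr_sqr ler_wsqrtr// lerDr sqr_ge0.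
Qed.

Lemma normc_sqr (z : R[i]) : normc z ^+ 2 = complex.Re z ^+ 2 + complex.Im z ^+ 2.
Proof. by case: z => a b /=; rewrite sqr_sqrtr// addr_ge0// sqr_ge0. Qed.

Lemma lipschitz_of_deriv (h dh : R -> R) (B x y : R) : x <= y ->
  (forall t, x <= t <= y -> is_derive t 1 h (dh t)) ->
  (forall t, x <= t <= y -> `|dh t| <= B) ->
  `|h y - h x| <= B * (y - x).
Proof.
move=> xy Dh le.
have [c cxy ->] : exists2 c, c \in `[x, y]%R & h y - h x = dh c * (y - x).
  apply: MVT_segment => //.
    move=> t; rewrite in_itv/= => /andP[/ltW xt /ltW ty]; apply: Dh.
    by rewrite xt.
  apply: derivable_within_continuous => t; rewrite in_itv/= => txy.
  by have [] := Dh t txy.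
rewrite normrM [`|y - x|]ger0_norm ?subr_ge0// ler_wpM2r ?subr_ge0//.
exact: le.
Qed.

(** The factor 2 comes from applying the mean value theorem to real and imaginary parts
    separately. *)
Lemma lipschitzC_of_deriv f (B x y : R) : x <= y ->
  (forall t, x <= t <= y -> derivableC f t) ->
  (forall t, x <= t <= y -> normc (derivC f t) <= B) ->
  normc (f y - f x) <= 2 * B * (y - x).
Proof.
move=> xy Df le; apply: (le_trans (normc_ReIm_le _)).
rewrite -mulrA mulr2n mulrDl mul1r; apply: lerD; rewrite raddfB/=.
  apply: (@lipschitz_of_deriv (re f) (fun t => complex.Re (derivC f t))) => // t txy.
    by have [] := derivableC_is_derivC (Df t txy).
  exact: le_trans (normc_Re _) (le t txy).
apply: (@lipschitz_of_deriv (im f) (fun t => complex.Im (derivC f t))) => // t txy.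
  by have [] := derivableC_is_derivC (Df t txy).
exact: le_trans (normc_Im _) (le t txy).
Qed.

Lemma abs_cont_lipschitz f (c d L : R) : 0 <= L ->
  (forall x y, c <= x -> x <= y -> y <= d -> normc (f y - f x) <= L * (y - x)) ->
  abs_cont f c d.
Proof.
move=> L0 Lf e e0; have L10 : 0 < L + 1 by rewrite ltr_wpDl.
exists (e / (L + 1)); first exact: divr_gt0.
move=> n l r lr _ sm.
apply: (@le_lt_trans _ _ (\sum_(i < n) L * (r i - l i))).
  by apply: ler_sum => i _; have [? [? ?]] := lr i; exact: Lf.
rewrite -mulr_sumr; apply: (@le_lt_trans _ _ ((L + 1) * \sum_(i < n) (r i - l i))).
  rewrite ler_wpM2r ?lerDl//; apply: sumr_ge0 => i _.
  by have [? [? ?]] := lr i; rewrite subr_ge0.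
by rewrite mulrC -ltr_pdivlMr.
Qed.

(** Each increment of the product splits as g(r) (f(r) - f(l)) + f(l) (g(r) - g(l)), with bounded
    coefficients. *)
Lemma abs_contM f g (c d B : R) :
  (forall t, c <= t <= d -> normc (f t) <= B) ->
  (forall t, c <= t <= d -> normc (g t) <= B) ->
  abs_cont f c d -> abs_cont g c d -> abs_cont (fun t => f t * g t) c d.
Proof.
move=> fB gB ACf ACg e e0.
pose B1 := `|B| + 1.
have B10 : 0 < B1 by rewrite ltr_wpDl.
have BB1 : B <= B1 by rewrite (le_trans (ler_norm _))// lerDl.
have e10 : 0 < e / 2 / B1 by rewrite !divr_gt0.
have [df df0 Hf] := ACf _ e10.
have [dg dg0 Hg] := ACg _ e10.
exists (Num.min df dg); first by rewrite lt_min df0.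
move=> n l r lr tr; rewrite lt_min => /andP[sf sg].
apply: (@le_lt_trans _ _ (B1 * \sum_(i < n) normc (f (r i) - f (l i)) +
                          B1 * \sum_(i < n) normc (g (r i) - g (l i)))).
  rewrite !mulr_sumr -big_split/=; apply: ler_sum => i _.
  have [cl [lri rd]] := lr i.
  have -> : f (r i) * g (r i) - f (l i) * g (l i) =
    g (r i) * (f (r i) - f (l i)) + f (l i) * (g (r i) - g (l i)) by ring.
  apply: (le_trans (normcD _ _)); rewrite !normcM; apply: lerD.
    apply: ler_wpM2r; first exact: normc_ge0.
    by apply: le_trans BB1; apply: gB; rewrite (le_trans cl lri).
  apply: ler_wpM2r; first exact: normc_ge0.
  by apply: le_trans BB1; apply: fB; rewrite cl (le_trans lri rd).
rewrite (splitr e); apply: ltrD.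
  by rewrite mulrC -ltr_pdivlMr//; exact: Hf.
by rewrite mulrC -ltr_pdivlMr//; exact: Hg.
Qed.

Lemma abs_contB f g (c d : R) :
  abs_cont f c d -> abs_cont g c d -> abs_cont (fun t => f t - g t) c d.
Proof.
move=> ACf ACg e e0.
have [df df0 Hf] := ACf _ (divr_gt0 e0 (ltr0Sn _ 1)).
have [dg dg0 Hg] := ACg _ (divr_gt0 e0 (ltr0Sn _ 1)).
exists (Num.min df dg); first by rewrite lt_min df0.
move=> n l r lr tr; rewrite lt_min => /andP[sf sg].
apply: (@le_lt_trans _ _ (\sum_(i < n) normc (f (r i) - f (l i)) +
                          \sum_(i < n) normc (g (r i) - g (l i)))).
  rewrite -big_split/=; apply: ler_sum => i _.
  rewrite [normc (g _ - _)]normc_distC.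
  have -> : f (r i) - g (r i) - (f (l i) - g (l i)) =
    (f (r i) - f (l i)) + (g (l i) - g (r i)) by ring.
  exact: normcD.
by rewrite (splitr e); apply: ltrD; [exact: Hf | exact: Hg].
Qed.

(** The squared modulus is differentiable even at zeros of u; the growth estimates are therefore
    proved for it and a square root is taken at the end. *)
Lemma is_derive_normc2 u x : derivableC u x ->
  is_derive x 1 (fun t => normc (u t) ^+ 2)
    (2 * complex.Re (derivC u x * (u x)^*)).
Proof.
move=> /derivableC_is_derivC; move: (derivC u x) => l [ur ui].
rewrite (_ : (fun t => _) = re u * re u + im u * im u); last first.
  by apply/funext => t; rewrite normc_sqr !fctE -!expr2.
apply: is_derive_eq; rewrite /GRing.scale/= /re /im.
by case: (u x) l {ur ui} => ? ? [? ?] /=; ring.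
Qed.

(* If neither limit exists, both are the junk value [point]. *)
Lemma lim_sub_le (T : pnbhsType) (F : set_system T) {FF : ProperFilter F} (f g : T -> R) (l : R) :
  (fun t => f t - g t) @ F --> l -> `|lim (f @ F) - lim (g @ F)| <= `|l|.
Proof.
move=> fgl; have [cf|ncf] := pselect (cvg (f @ F)).
  have cg : g @ F --> lim (f @ F) - l.
    suff -> : g = f - (fun t => f t - g t) by exact: cvgB.
    by apply/funext => t; rewrite !fctE opprB addrC subrK.
  by rewrite (cvg_lim _ cg)// opprB addrC subrK.
rewrite (dvgP ncf) dvgP ?subrr ?normr0// => cg; apply: ncf.
apply/cvg_ex; exists (l + lim (g @ F)).
suff -> : f = (fun t => f t - g t) + g by exact: cvgD.
by apply/funext => t; rewrite !fctE subrK.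
Qed.

(** The function h(x) + L x is nondecreasing and bounded below near 0, so it has a limit at 0+; then
    L x is subtracted again. *)
Lemma lipschitz_cvg (h : R -> R) (a L : R) : 0 < a ->
  (forall x y, 0 < x -> x <= y -> y <= a -> `|h y - h x| <= L * (y - x)) ->
  cvg (h x @[x --> 0^'+]).
Proof.
move=> a0 Lh.
have L0 : 0 <= L.
  have := Lh (a / 2) a; rewrite divr_gt0// ler_pdivrMr// ler_peMr ?ler1n ?(ltW a0)//.
  move=> /(_ isT isT (lexx _)) /(le_trans (normr_ge0 _)).
  by rewrite pmulr_lge0// subr_gt0 ltr_pdivrMr// ltr_pMr// ltr1n.
have c1 : cvg ((fun x => h x + L * x) @ 0^'+).
  apply: nondecreasing_at_right_is_cvgr.
    near=> z => x y; rewrite !in_itv/= => /andP[x0 xz] /andP[y0 yz] xy.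
    have /Lh /(_ xy) : 0 < x by [].
    have za : z <= a by near: z; exact: nbhs_right_le.
    move=> /(_ (le_trans (ltW yz) za)); rewrite ler_norml => /andP[H _].
    by move: H; rewrite mulrBr; lra.
  near=> z; exists (h a - L * a) => _ [x /= + <-]; rewrite in_itv/= => /andP[x0 xz].
  have za : z <= a by near: z; exact: nbhs_right_le.
  have /Lh /(_ (le_trans (ltW xz) za) (lexx a)) : 0 < x by [].
  rewrite ler_norml => /andP[_]; rewrite mulrBr.
  have : 0 <= L * x by rewrite mulr_ge0// ltW.
  by lra.
have c2 : (fun x : R => L * x) @ 0^'+ --> L * 0.
  by apply: cvgMr; apply: cvg_at_right_filter; exact: cvg_id.
apply/cvg_ex; exists (lim ((fun x => h x + L * x) @ 0^'+) - L * 0).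
have H : (fun x => h x + L * x) - (fun x => L * x) = h.
  by apply/funext => t; rewrite !fctE addrK.
by rewrite -[X in X @ _]H; exact: cvgB c1 c2.
Unshelve. all: by end_near. Qed.

End Deriv.

(** * Growth of solutions, constancy of the Wronskian, and the gap between m-functions *)

Section MFunctions.
Variable R : realType.
Implicit Types (u v : R -> R[i]) (q : R -> R) (k z : R[i]) (x y t : R).
Local Notation mu := (@lebesgue_measure R).

(** The derivative of |u|^2 is 2 Re(u' / u) |u|^2, and Re(u' / u) lies between - (C + |k|) and C -
    Re k. The upper bound gives the decay that produces the final exponential; the lower one bounds
    u on (0, a] by its value at a, so no behaviour at 0 has to be assumed. *)
Lemma m_bound_growth (a C : R) k u : C < complex.Re k ->
  (forall x, 0 < x <= a -> derivableC u x) ->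
  (forall x, 0 < x <= a -> normc (derivC u x / u x + k) <= C) ->
  [/\ forall x, 0 < x <= a -> u x != 0,
      forall x, 0 < x <= a -> normc (derivC u x) <= (C + normc k) * normc (u x),
      forall x y, 0 < x -> x <= y -> y <= a ->
        normc (u y) <= normc (u x) * expR ((C - complex.Re k) * (y - x))
    & forall x y, 0 < x -> x <= y -> y <= a ->
        normc (u x) <= normc (u y) * expR ((C + normc k) * (y - x))].
Proof.
move=> Ck Du ub.
have u0 x : 0 < x <= a -> u x != 0.
  (* At a zero of u the junk value u' / u = 0 would give normc k <= C. *)
  move=> xa; apply/eqP => ux0; have := ub x xa; rewrite ux0 invr0 mulr0 add0r => H.
  by have := le_trans (le_trans (ler_norm _) (normc_Re k)) H; rewrite leNgt Ck.
have dE x : 0 < x <= a -> derivC u x = derivC u x / u x * u x.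
  by move=> xa; rewrite mulfVK// u0.
have rle x : 0 < x <= a -> complex.Re (derivC u x / u x) <= C - complex.Re k.
  move=> xa; rewrite lerBrDr -raddfD/=.
  exact: le_trans (le_trans (ler_norm _) (normc_Re _)) (ub x xa).
have nle x : 0 < x <= a -> normc (derivC u x / u x) <= C + normc k.
  move=> xa; rewrite -[derivC u x / u x](addrK k); apply: (le_trans (normcD _ _)).
  by apply: lerD; [exact: ub | rewrite -[- k]sub0r normc_distC subr0].
have d2E x : 0 < x <= a -> 2 * complex.Re (derivC u x * (u x)^*) =
    2 * complex.Re (derivC u x / u x) * normc (u x) ^+ 2.
  move=> xa; rewrite {1}(dE x xa) normc_sqr.
  by case: (u x) (derivC u x / u x) => ? ? [? ?] /=; ring.
split => //.
- move=> x xa; rewrite {1}(dE x xa) normcM ler_wpM2r ?normc_ge0//.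
  exact: nle.
- move=> x y x0 xy ya.
  have txa t : x <= t <= y -> 0 < t <= a.
    by move=> /andP[xt ty]; rewrite (lt_le_trans x0 xt) (le_trans ty ya).
  rewrite -ler_sqr ?nnegrE ?mulr_ge0 ?normc_ge0 ?expR_ge0//.
  rewrite exprMn -expRM_natl.
  rewrite [X in expR X]mulrA.
  apply: (gronwall (g := fun t => normc (u t) ^+ 2) xy
    (fun t txy => is_derive_normc2 (Du t (txa t txy)))) => t /txa ta.
  rewrite d2E// -!mulrA ler_pM2l//; apply: ler_wpM2r; first exact: sqr_ge0.
  exact: rle.
- move=> x y x0 xy ya.
  have txa t : x <= t <= y -> 0 < t <= a.
    by move=> /andP[xt ty]; rewrite (lt_le_trans x0 xt) (le_trans ty ya).
  rewrite -ler_sqr ?nnegrE ?mulr_ge0 ?normc_ge0 ?expR_ge0//.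
  rewrite exprMn -expRM_natl.
  (* Changing the sign of |u|^2 turns the lower bound on its logarithmic derivative into the upper
     bound that [gronwall] expects. *)
  have H := gronwall (g := - (fun t => normc (u t) ^+ 2)) (lam := - (2 * (C + normc k))) xy
    (fun t txy => is_deriveN (is_derive_normc2 (Du t (txa t txy)))).
  have {}H : - normc (u y) ^+ 2 <= - normc (u x) ^+ 2 * expR (- (2 * (C + normc k)) * (y - x)).
    apply: H => t /txa ta; rewrite d2E// !fctE mulrNN lerNl -mulNr.
    apply: ler_wpM2r; first exact: sqr_ge0.
    rewrite -mulrN ler_pM2l// lerNl.
    by apply: le_trans (nle t ta); rewrite (le_trans _ (normc_Re _))// -normrN ler_norm.
  move: H; rewrite mulNr lerN2 => H.
  rewrite -(@ler_pM2r _ (expR (- (2 * (C + normc k)) * (y - x)))) ?expR_gt0//.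
  apply: (le_trans H); rewrite -mulrA -expRD.
  have -> : 2 * ((C + normc k) * (y - x)) + - (2 * (C + normc k)) * (y - x) = 0 by ring.
  by rewrite expR0 mulr1.
Qed.

(** The bound B makes u1 and u2 Lipschitz and lets products of absolutely continuous functions stay
    so; hence W is absolutely continuous. Its derivative is u1 u2'' - u1'' u2, which vanishes almost
    everywhere because u1'' and u2'' carry the same factor q - z. *)
Lemma wronskian_const q1 q2 (b1 b2 : \bar R) z u1 u2 (c d B : R) :
  0 < c -> c <= d -> (d%:E < b1)%E -> (d%:E < b2)%E ->
  solution q1 b1 z u1 -> solution q2 b2 z u2 ->
  {ae mu, forall x, c <= x <= d -> q1 x = q2 x} ->
  (forall t, c <= t <= d -> [/\ normc (u1 t) <= B, normc (u2 t) <= B,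
     normc (derivC u1 t) <= B & normc (derivC u2 t) <= B]) ->
  wronskian u1 u2 d = wronskian u1 u2 c.
Proof.
move=> c0 cd db1 db2 [D1 AC1 ae1] [D2 AC2 ae2] q12 Bd.
have Dt (b : \bar R) t : (d%:E < b)%E -> c <= t <= d -> 0 < t /\ (t%:E < b)%E.
  by move=> db /andP[ct td]; rewrite (lt_le_trans c0 ct) (le_lt_trans _ db)// lee_fin.
have B0 : 0 <= B.
  by have [|H _ _ _] := Bd c; rewrite ?lexx//; exact: le_trans (normc_ge0 _) H.
have ACu (b : \bar R) u : (d%:E < b)%E -> (forall x, 0 < x -> (x%:E < b)%E -> derivableC u x) ->
    (forall t, c <= t <= d -> normc (derivC u t) <= B) -> abs_cont u c d.
  move=> db Du ub; apply: (@abs_cont_lipschitz _ _ _ _ (2 * B)); first by rewrite mulr_ge0.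
  move=> x y cx xy yd.
  have txy t : x <= t <= y -> c <= t <= d.
    by move=> /andP[xt ty]; rewrite (le_trans cx xt) (le_trans ty yd).
  apply: lipschitzC_of_deriv => // t /txy tcd; last exact: ub.
  by have [] := Dt b t db tcd; exact: Du.
apply: abs_cont_derivC0 => //.
  apply: abs_contB.
    apply: (@abs_contM _ _ _ _ _ B); [by move=> t /Bd[] | by move=> t /Bd[] | | exact: AC2].
    by apply: (ACu b1) => // t /Bd[].
  apply: (@abs_contM _ _ _ _ _ B); [by move=> t /Bd[] | by move=> t /Bd[] | exact: AC1 |].
  by apply: (ACu b2) => // t /Bd[].
have FF : Filter (nbhs (almost_everywhere mu)).
  exact: (ae_filter_ringOfSetsType (@lebesgue_measure R)).
apply: filterS3 ae1 ae2 q12 => x E1 E2 q12 xcd.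
have [x0 xb1] := Dt b1 x db1 xcd; have [_ xb2] := Dt b2 x db2 xcd.
have [DD1 {}E1] := E1 x0 xb1; have [DD2 {}E2] := E2 x0 xb2; have {}q12 := q12 xcd.
have := is_derivCB
  (is_derivCM (derivableC_is_derivC (D1 x x0 xb1)) (derivableC_is_derivC DD2))
  (is_derivCM (derivableC_is_derivC DD1) (derivableC_is_derivC (D2 x x0 xb2))).
move=> /is_derivC_val[DW ->]; split => //.
have F1 : derivC (derivC u1) x = (q1 x)%:C * u1 x - z * u1 x by rewrite -E1; ring.
have F2 : derivC (derivC u2) x = (q1 x)%:C * u2 x - z * u2 x by rewrite q12 -E2; ring.
by rewrite F1 F2; ring.
Qed.

Lemma limC_sub_le (f g : R -> R[i]) (a L M : R) (e : R -> R) : 0 < a ->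
  (forall x y, 0 < x -> x <= y -> y <= a ->
     normc ((f y - g y) - (f x - g x)) <= L * (y - x)) ->
  (forall x, 0 < x <= a -> normc (f x - g x) <= e x) ->
  e x @[x --> 0^'+] --> M ->
  normc (limC 0^'+ f - limC 0^'+ g) <= M.
Proof.
move=> a0 Lfg fge eM.
have M0 : 0 <= M.
  apply: (ler_cvg_to (@cvg_cst _ (0 : R) _ 0^'+ _) eM); near=> x.
  apply: le_trans (fge x _); first exact: normc_ge0.
  by apply/andP; split; near: x; [exact: nbhs_right_gt | exact: nbhs_right_le].
have cr : cvg (re f x - re g x @[x --> 0^'+]).
  apply: (lipschitz_cvg a0) => x y x0 xy ya; apply: le_trans (Lfg x y x0 xy ya).
  by apply: le_trans (normc_Re _); rewrite !raddfB.
have ci : cvg (im f x - im g x @[x --> 0^'+]).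
  apply: (lipschitz_cvg a0) => x y x0 xy ya; apply: le_trans (Lfg x y x0 xy ya).
  by apply: le_trans (normc_Im _); rewrite !raddfB.
set lr := lim _ in cr; set li := lim _ in ci.
have hr : `|lim (re f @ 0^'+) - lim (re g @ 0^'+)| <= `|lr| by exact: lim_sub_le cr.
have hi : `|lim (im f @ 0^'+) - lim (im g @ 0^'+)| <= `|li| by exact: lim_sub_le ci.
(* The limit is taken in |f - g|^2 <= e^2, which combines the two components without losing a
   constant. *)
have lM : lr ^+ 2 + li ^+ 2 <= M ^+ 2.
  have c1 : (re f x - re g x) * (re f x - re g x) + (im f x - im g x) * (im f x - im g x)
      @[x --> 0^'+] --> lr * lr + li * li.
    by apply: cvgD; [exact: (cvgM cr cr) | exact: (cvgM ci ci)].
  have c2 : e x * e x @[x --> 0^'+] --> M * M by exact: (cvgM eM eM).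
  rewrite !expr2; apply: (ler_cvg_to c1 c2); near=> x.
  rewrite -!expr2.
  have xa : 0 < x <= a.
    by apply/andP; split; near: x; [exact: nbhs_right_gt | exact: nbhs_right_le].
  have := fge x xa; rewrite -(@ler_pXn2r _ 2)// ?nnegrE ?normc_ge0//; last first.
    exact: le_trans (normc_ge0 _) (fge x xa).
  by rewrite normc_sqr !raddfB.
rewrite -(@ler_pXn2r _ 2)// ?nnegrE ?normc_ge0// normc_sqr !raddfB/=.
apply: le_trans lM; apply: lerD; rewrite -[leLHS]real_normK ?num_real// -[leRHS]real_normK ?num_real//.
  by rewrite ler_pXn2r ?nnegrE.
by rewrite ler_pXn2r ?nnegrE.
Unshelve. all: by end_near. Qed.

Lemma m_function_gap q1 q2 (b1 b2 : \bar R) z k u1 u2 (a C : R) :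
  0 < a -> (a%:E < b1)%E -> (a%:E < b2)%E ->
  solution q1 b1 z u1 -> solution q2 b2 z u2 ->
  {ae mu, forall x, 0 <= x <= a -> q1 x = q2 x} ->
  C < complex.Re k ->
  (forall x, 0 < x <= a -> normc (derivC u1 x / u1 x + k) <= C) ->
  (forall x, 0 < x <= a -> normc (derivC u2 x / u2 x + k) <= C) ->
  normc (limC 0^'+ (fun t => derivC u1 t / u1 t) -
         limC 0^'+ (fun t => derivC u2 t / u2 t))
    <= 2 * C * expR (- (2 * a * (complex.Re k - C))).
Proof.
move=> a0 ab1 ab2 S1 S2 q12 Ck m1 m2.
have Du (b : \bar R) q u : (a%:E < b)%E -> solution q b z u ->
    forall x, 0 < x <= a -> derivableC u x.
  move=> ab [Du _ _] x /andP[x0 xa]; apply: Du => //.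
  by rewrite (le_lt_trans _ ab)// lee_fin.
have [nz1 d1 dec1 inc1] := m_bound_growth Ck (Du _ _ _ ab1 S1) m1.
have [nz2 d2 dec2 inc2] := m_bound_growth Ck (Du _ _ _ ab2 S2) m2.
pose M := C + normc k.
have C0 : 0 <= C by apply: le_trans (m1 a _); rewrite ?normc_ge0// a0 lexx.
have M0 : 0 <= M by rewrite addr_ge0 ?normc_ge0.
pose P t := u1 t * u2 t.
pose D t := derivC u1 t / u1 t - derivC u2 t / u2 t.
pose W := wronskian u1 u2 a.
(* One bound for both solutions: the backward growth factor over (0, a] times the sum of the moduli
   at a. *)
pose B := (normc (u1 a) + normc (u2 a)) * expR (M * a).
have B0 : 0 <= B by rewrite mulr_ge0 ?expR_ge0// addr_ge0 ?normc_ge0.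
have uB u : (forall x y, 0 < x -> x <= y -> y <= a ->
        normc (u x) <= normc (u y) * expR (M * (y - x))) ->
    normc (u a) <= normc (u1 a) + normc (u2 a) ->
    forall x, 0 < x <= a -> normc (u x) <= B.
  move=> inc le x /andP[x0 xa]; apply: (le_trans (inc x a x0 xa (lexx _))).
  apply: ler_pM => //; rewrite ?normc_ge0 ?expR_ge0// ler_expR ler_wpM2l//.
  by rewrite gerBl ltW.
have u1B x : 0 < x <= a -> normc (u1 x) <= B by apply: uB => //; rewrite lerDl normc_ge0.
have u2B x : 0 < x <= a -> normc (u2 x) <= B by apply: uB => //; rewrite lerDr normc_ge0.
have du1B x : 0 < x <= a -> normc (derivC u1 x) <= M * B.
  by move=> xa; apply: (le_trans (d1 x xa)); rewrite ler_wpM2l// u1B.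
have du2B x : 0 < x <= a -> normc (derivC u2 x) <= M * B.
  by move=> xa; apply: (le_trans (d2 x xa)); rewrite ler_wpM2l// u2B.
have Wc x : 0 < x <= a -> wronskian u1 u2 x = W.
  move=> /andP[x0 xa]; apply/esym.
  apply: (@wronskian_const q1 q2 b1 b2 z _ _ x a (Num.max B (M * B))) => //.
    have FF : Filter (nbhs (almost_everywhere mu)).
      exact: (ae_filter_ringOfSetsType (@lebesgue_measure R)).
    apply: filterS q12 => t + /andP[xt ta]; apply.
    by rewrite (le_trans (ltW x0) xt).
  move=> t /andP[xt ta]; have tp : 0 < t <= a by rewrite (lt_le_trans x0 xt).
  split; rewrite le_max; apply/orP;
    [left; exact: u1B | left; exact: u2B | right; exact: du1B | right; exact: du2B].
have Pnz x : 0 < x <= a -> P x != 0 by move=> xa; rewrite mulf_neq0 ?nz1 ?nz2.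
have DE x : 0 < x <= a -> D x = - W / P x.
  move=> xa; rewrite -(Wc x xa) /D /P /wronskian; field.
  by rewrite nz1 ?nz2.
have aa : 0 < a <= a by rewrite a0 lexx.
(* Both factors of P decay at rate C - Re k, whence the factor 2 in the exponent. *)
have Pa x : 0 < x <= a ->
    normc (P a) <= normc (P x) * expR (2 * ((C - complex.Re k) * (a - x))).
  move=> /andP[x0 xa]; rewrite /P !normcM mulr2n mulrDl mul1r expRD mulrACA.
  by apply: ler_pM; rewrite ?normc_ge0 ?dec1 ?dec2.
have Pa0 : 0 < normc (P a).
  rewrite lt_neqAle normc_ge0 andbT eq_sym; apply/eqP => /eq0_normc/eqP.
  by apply/negP; exact: Pnz.
(* This keeps P away from 0 uniformly on (0, a], as the Lipschitz bound for D requires. *)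
have Pge x : 0 < x <= a -> normc (P a) <= normc (P x).
  move=> xa; apply: (le_trans (Pa x xa)); rewrite ler_piMr ?normc_ge0//.
  rewrite -expR0 ler_expR; apply: mulr_ge0_le0 => //; apply: mulr_le0_ge0.
    by rewrite subr_le0 ltW.
  by rewrite subr_ge0; case/andP: xa.
(* Here 2 M B^2 bounds |P'|, the outer 2 is that of [lipschitzC_of_deriv], and |P(a)|^2 bounds the
   denominator P(x) P(y) from below. *)
apply: (@limC_sub_le _ _ a (normc W * (2 * (2 * (M * B * B))) / normc (P a) ^+ 2) _
  (fun x => 2 * C * expR (2 * ((C - complex.Re k) * (a - x))))) => //.
- move=> x y x0 xy ya; rewrite -!/(D _).
  have xa : 0 < x <= a by rewrite x0 (le_trans xy ya).
  have {}ya : 0 < y <= a by rewrite (lt_le_trans x0 xy).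
  have -> : D y - D x = W * (P y - P x) / (P x * P y).
    by rewrite !DE//; field; rewrite !Pnz.
  rewrite normcM [normc (W * _)]normcM normcV [normc (P x * _)]normcM.
  have PL : normc (P y - P x) <= 2 * (2 * (M * B * B)) * (y - x).
    apply: lipschitzC_of_deriv => // t /andP[xt ty].
      have ta : 0 < t <= a.
        by case/andP: ya => _ ya; rewrite (lt_le_trans x0 xt) (le_trans ty ya).
      by have [] := is_derivC_val (is_derivCM (derivableC_is_derivC (Du _ _ _ ab1 S1 t ta))
        (derivableC_is_derivC (Du _ _ _ ab2 S2 t ta))).
    have ta : 0 < t <= a.
      by case/andP: ya => _ ya; rewrite (lt_le_trans x0 xt) (le_trans ty ya).
    have [_ ->] := is_derivC_val (is_derivCM (derivableC_is_derivC (Du _ _ _ ab1 S1 t ta))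
        (derivableC_is_derivC (Du _ _ _ ab2 S2 t ta))).
    apply: (le_trans (normcD _ _)); rewrite !normcM [leRHS]mulr_natl mulr2n; apply: lerD.
      by apply: ler_pM; rewrite ?normc_ge0 ?du1B ?u2B.
    by rewrite [leRHS]mulrC; apply: ler_pM; rewrite ?normc_ge0 ?du2B ?u1B.
  have -> : normc W * (2 * (2 * (M * B * B))) / normc (P a) ^+ 2 * (y - x) =
    normc W * (2 * (2 * (M * B * B)) * (y - x) / normc (P a) ^+ 2) by ring.
  rewrite -[leLHS]mulrA; apply: ler_wpM2l; first exact: normc_ge0.
  apply: ler_pM; rewrite ?normc_ge0 ?invr_ge0 ?mulr_ge0 ?normc_ge0//.
  rewrite lef_pV2 ?posrE ?mulr_gt0 ?exprn_gt0//.
  - by rewrite expr2; apply: ler_pM; rewrite ?normc_ge0 ?Pge.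
  - exact: lt_le_trans Pa0 (Pge x xa).
  - exact: lt_le_trans Pa0 (Pge y ya).
- move=> x xa; rewrite -/(D x).
  have Da : normc (D a) <= 2 * C.
    have -> : D a = (derivC u1 a / u1 a + k) - (derivC u2 a / u2 a + k) by rewrite /D; ring.
    rewrite -[X in X - _]addr0 -addrA add0r; apply: (le_trans (normcD _ _)).
    rewrite -[- (_ + _)]sub0r [X in _ + X]normc_distC subr0 [leRHS]mulr_natl mulr2n.
    by apply: lerD; [exact: m1 | exact: m2].
  (* Since D P is the constant - W, the bound at a is transported to x by the ratio of the values of
     P. *)
  have -> : D x = D a * P a / P x.
    by rewrite !DE//; field; rewrite !Pnz.
  rewrite normcM [normc (D a * _)]normcM normcV -mulrA; apply: ler_pM; rewrite ?normc_ge0//.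
    by rewrite divr_ge0 ?normc_ge0.
  rewrite ler_pdivrMr; first by rewrite mulrC Pa.
  exact: lt_le_trans Pa0 (Pge x xa).
- rewrite (_ : - (2 * a * _) = 2 * ((C - complex.Re k) * (a - 0))); last by ring.
  apply: cvgMr; apply: continuous_cvg; first exact: continuous_expR.
  apply: cvgMr; apply: cvgMr; apply: cvgB; first exact: cvg_cst.
  by apply: cvg_at_right_filter; exact: cvg_id.
Qed.

End MFunctions.

(** * The estimate for k in the sector *)

Theorem theorem1p5 (R : realType) (a eps K0 C : R)
    (e1 e2 : endpoint R) (q1 q2 : R -> R) (u1 u2 : R[i] -> R -> R[i])
    (ha : 0 < a) (heps : 0 < eps) (hK0 : 0 < K0) (hC : 0 < C)
    (hb1 : (a%:E < right_end e1)%E) (hb2 : (a%:E < right_end e2)%E)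
    (hq1 : admissible e1 q1) (hq2 : admissible e2 q2)
    (hu1 : forall z : R[i], 0 < complex.Im z -> weyl_solution e1 q1 z (u1 z))
    (hu2 : forall z : R[i], 0 < complex.Im z -> weyl_solution e2 q2 z (u2 z))
    (hq : {ae @lebesgue_measure R, forall x : R, 0 <= x <= a -> q1 x = q2 x})
    (hm : forall (x : R) (k : R[i]), 0 <= x <= a ->
       - (pi / 2) + eps < Arg k < - eps -> K0 <= normc k ->
       normc (m_fun (u1 (- k ^+ 2)) x + k) <= C /\
       normc (m_fun (u2 (- k ^+ 2)) x + k) <= C) :
  forall k : R[i],
    - (pi / 2) + eps < Arg k < - eps -> K0 <= normc k ->
    normc (m_fun (u1 (- k ^+ 2)) 0 - m_fun (u2 (- k ^+ 2)) 0)
      <= 2 * C * expR (- (2 * a * (complex.Re k - C))).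
Proof.
move=> k karg kK.
have aa : 0 <= a <= a by rewrite (ltW ha) lexx.
have [m10 m20] : normc (m_fun (u1 (- k ^+ 2)) 0 + k) <= C /\
                 normc (m_fun (u2 (- k ^+ 2)) 0 + k) <= C.
  by apply: hm => //; rewrite lexx ltW.
(* For Re k <= C the exponential is at least 1, so the bound 2 C from the triangle inequality at 0
   suffices. *)
have [kC|Ck] := leP (complex.Re k) C.
  set m1 := m_fun _ _ in m10 *; set m2 := m_fun _ _ in m20 *.
  have -> : m1 - m2 = (m1 + k) + (- (m2 + k)) by ring.
  apply: (le_trans (normcD _ _)).
  rewrite -[- (_ + _)]sub0r [X in _ + X]normc_distC subr0.
  apply: (le_trans (lerD m10 m20)); rewrite -[C + C]mulr1 -mulr2n -[C *+ 2]mulr_natl.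
  rewrite ler_pM2l ?mulr_gt0// -expR0 ler_expR oppr_ge0.
  by rewrite mulr_ge0_le0 ?subr_le0// mulr_ge0// ltW.
(* If Im k >= 0, then [Arg] is an arccosine, hence nonnegative, against [Arg k] < - eps < 0. *)
have Imk : complex.Im k < 0.
  rewrite ltNge; apply/negP => k0; move: karg; rewrite /Arg k0 => /andP[_].
  rewrite ltNge => /negP; apply; apply: (@le_trans _ _ 0); first by rewrite oppr_le0 ltW.
  apply: acos_ge0; rewrite -ler_norml normrM normfV (ger0_norm (normc_ge0 k)).
  have n0 : 0 < normc k by exact: lt_le_trans kK.
  by rewrite ler_pdivrMr// mul1r normc_Re.
(* Im(- k^2) = - 2 Re k Im k, where Re k > C > 0 and Im k < 0; so - k^2 lies in the upper
   half-plane, where the Weyl solutions are given. *)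
have Imz : 0 < complex.Im (- k ^+ 2).
  have : 0 < complex.Re k by exact: lt_trans Ck.
  by case: k Imk {karg kK Ck m10 m20} => x y /=; rewrite oppr_gt0; nra.
have [S1 _ _] := hu1 _ Imz; have [S2 _ _] := hu2 _ Imz.
rewrite /m_fun eqxx.
apply: (m_function_gap ha hb1 hb2 S1 S2 hq Ck) => x /andP[x0 xa].
  by have := hm x k; rewrite (ltW x0) xa /m_fun gt_eqF// => /(_ isT karg kK)[].
by have := hm x k; rewrite (ltW x0) xa /m_fun gt_eqF// => /(_ isT karg kK)[].
Qed.
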